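(* Assume that $\mathsf{A}_2\in\mathbb{R}^{m\times n_2}$ and $\mathrm{rank}(\mathsf{A}_2)=n_2<m$. Consider the model $B=\mathsf{A}_1X_1+\mathsf{A}_2X_2+E$ with $X_1,X_2,E$ and the prior of $X_2$, depending on a scaling parameter $\alpha>0$, as described in the context. As the prior for $X_2$ becomes uninformative ($\alpha\to0$), the marginal probability density of $X_1$, $$\pi^\alpha_{X_1\mid B}(x_1\mid b)=\int \pi^\alpha_{X_1,X_2\mid B}(x_1,x_2\mid b)\,dx_2,$$ converges to the posterior density for the projected problem $b'=\mathsf{A}_1'x_1+\varepsilon'$, i.e., for some constant $C>0$, $$\lim_{\alpha\to0}\alpha^{-n_2}\,\pi^\alpha_{X_1\mid B}(x_1\mid b)=C\,\pi_{X_1}(x_1)\,\pi_{B'\mid X_1}(b'\mid x_1).$$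
   Context: Here $\mathsf{A}_1\in\mathbb{R}^{m\times n_1}$ and $\mathsf{A}_2\in\mathbb{R}^{m\times n_2}$ are known matrices. $X_1$ is a zero-mean Gaussian random variable in $\mathbb{R}^{n_1}$ with symmetric positive definite covariance and prior density $\pi_{X_1}$. $X_2$ is a Gaussian random variable in $\mathbb{R}^{n_2}$, independent of $X_1$, with prior density $\pi^\alpha_{X_2}$ of $\mathcal{N}(0,\alpha^{-2}\mathsf{G})$, where $\mathsf{G}$ is symmetric positive definite (without loss of generality, via a whitening transformation, $\mathsf{G}=\mathsf{I}$) and $\alpha>0$ is a scaling parameter. The noise $E\sim\mathcal{N}(0,\mathsf{I})$ in $\mathbb{R}^m$ is independent of $(X_1,X_2)$. The vector $b\in\mathbb{R}^m$ is the observed value of $B$, and $\varepsilon$ denotes the realization of $E$. $\pi^\alpha_{X_1,X_2\mid B}$ denotes the conditional joint density of $(X_1,X_2)$ given $B=b$ for this choice of prior, which satisfies $$\pi^\alpha_{X_1,X_2\mid B}(x_1,x_2\mid b)\propto \pi_{X_1}(x_1)\,\pi^\alpha_{X_2}(x_2)\,\exp\!\big(-\tfrac12\|b-\mathsf{A}_1x_1-\mathsf{A}_2x_2\|^2\big),$$ with $\|\cdot\|$ the Euclidean norm. $\mathsf{P}^\perp$ is the orthogonal projector of $\mathbb{R}^m$ onto the orthogonal complement of the range of $\mathsf{A}_2$, and $b'=\mathsf{P}^\perp b$, $\mathsf{A}_1'=\mathsf{P}^\perp\mathsf{A}_1$, $\varepsilon'=\mathsf{P}^\perp\varepsilon$.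 The likelihood of the projected problem is $\pi_{B'\mid X_1}(b'\mid x_1)\propto\exp\!\big(-\tfrac12\|b'-\mathsf{A}_1'x_1\|^2\big)$, and its posterior density is proportional to $\pi_{X_1}(x_1)\,\pi_{B'\mid X_1}(b'\mid x_1)$.
   Formalization: For the normalized marginal the displayed limit diverges when n2>0; it is proved with the normalizing constant of the joint density multiplied back in (not divided out), and the normalized marginal is shown to converge pointwise to the normalized projected posterior. *)

(* Defs.v *)
From HB Require Import structures.
From mathcomp Require Import all_boot all_order all_algebra.
From mathcomp Require Import all_classical all_reals all_analysis.

Set Implicit Arguments.
Unset Strict Implicit.
Unset Printing Implicit Defensive.

Import Order.TTheory GRing.Theory Num.Theory.
Import numFieldTopology.Exports numFieldNormedType.Exports.

Local Open Scope classical_set_scope.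
Local Open Scope ring_scope.

(* 'M[R]_(p, q), in particular R^n = 'cV[R]_n, carries the sigma-algebra
   generated by the entries (the Borel one), as the library does for
   n.-tuple R *)
Section measurable_matrix.
Context {R : realType} (p q : nat).

Definition mx_measurable : set (set 'M[R]_(p, q)) :=
  <<s \bigcup_(ij in [set: 'I_p * 'I_q])
        preimage_set_system setT (fun M : 'M[R]_(p, q) => M ij.1 ij.2)
          measurable >>.

Let mx_measurable0 : mx_measurable set0.
Proof. exact: sigma_algebra0. Qed.

Let mx_measurableC A : mx_measurable A -> mx_measurable (~` A).
Proof. exact: sigma_algebraC. Qed.

Let mx_measurable_bigcup (F : (set 'M[R]_(p, q))^nat) :
  (forall i, mx_measurable (F i)) -> mx_measurable (\bigcup_i (F i)).
Proof. exact: sigma_algebra_bigcup. Qed.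

HB.instance Definition _ := @isMeasurable.Build default_measure_display
  'M[R]_(p, q) mx_measurable mx_measurable0 mx_measurableC mx_measurable_bigcup.

Lemma measurable_mx_coord (i : 'I_p) (j : 'I_q) :
  measurable_fun setT (fun M : 'M[R]_(p, q) => M i j).
Proof.
move=> _ A mA; rewrite setTI; apply: sub_sigma_algebra.
by exists (i, j) => //; exists A => //; rewrite setTI.
Qed.

Lemma measurable_fun_mxP d (T : measurableType d) (f : T -> 'M[R]_(p, q)) :
  (forall i j, measurable_fun setT (fun t => f t i j)) -> measurable_fun setT f.
Proof.
move=> mf; apply: (measurability (\bigcup_(ij in [set: 'I_p * 'I_q])
  preimage_set_system setT (fun M : 'M[R]_(p, q) => M ij.1 ij.2) measurable)).
  by [].
move=> _ [_ [[i j] _ [B mB <-]] <-].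
rewrite !setTI -comp_preimage -[X in measurable X]setTI.
exact: (mf i j).
Qed.

End measurable_matrix.

(* Lebesgue measure on R^n, built as lambda \x ... \x lambda along
   R^(n+1) = R x R^n *)
Section lebesgue_measure_cV.
Context {R : realType}.

Definition consv (n : nat) (z : R * 'cV[R]_n) : 'cV[R]_n.+1 :=
  col_mx (const_mx z.1 : 'cV_1) z.2.

Definition unconsv (n : nat) (v : 'cV[R]_n.+1) : R * 'cV[R]_n :=
  (v ord0 ord0, dsubmx (v : 'cV_(1 + n))).

Lemma consvK n : cancel (@consv n) (@unconsv n).
Proof.
move=> [x v]; rewrite /unconsv /consv /= col_mxKd; congr pair.
transitivity (col_mx (const_mx x : 'cV_1) v (lshift n (ord0 : 'I_1)) ord0).
  by congr (fun_of_matrix _ _ _); exact/val_inj.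
by rewrite col_mxEu mxE.
Qed.

Lemma measurable_consv n : measurable_fun setT (@consv n).
Proof.
apply: measurable_fun_mxP => i j.
have [k ik|k ik] := split_ordP (i : 'I_(1 + n)).
- have -> : (fun z => @consv n z i j) = fst.
    apply/funext => z; rewrite /consv ik.
    by apply: etrans (col_mxEu _ _ _ _) _; rewrite mxE.
  exact: measurable_fst.
- have -> : (fun z => @consv n z i j) = (fun v : 'cV[R]_n => v k j) \o snd.
    by apply/funext => z; rewrite /consv ik; exact: col_mxEd.
  by apply: measurableT_comp; [exact: measurable_mx_coord|exact: measurable_snd].
Qed.

Lemma measurable_unconsv n : measurable_fun setT (@unconsv n).
Proof.
apply/measurable_fun_pairP; split => /=; first exact: measurable_mx_coord.
apply: measurable_fun_mxP => i j.
under eq_fun do rewrite /= mxE; exact: measurable_mx_coord.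
Qed.

Section step.
Variables (n : nat) (mu : {sigma_finite_measure set 'cV[R]_n -> \bar R}).

Definition lebesgue_step (A : set 'cV[R]_n.+1) : \bar R :=
  (lebesgue_measure \x mu)%E (@consv n @^-1` A).

Let step0 : lebesgue_step set0 = 0%E.
Proof. by rewrite /lebesgue_step preimage_set0 measure0. Qed.

Let mpre A : measurable A -> measurable (@consv n @^-1` A).
Proof. by move=> mA; rewrite -[X in measurable X]setTI; exact: measurable_consv. Qed.

Let step_ge0 A : (0 <= lebesgue_step A)%E.
Proof. exact: measure_ge0. Qed.

Let step_sigma_additive : semi_sigma_additive lebesgue_step.
Proof.
move=> F mF tF mUF; rewrite /lebesgue_step preimage_bigcup.
apply: measure_semi_sigma_additive.
- by move=> k; exact: mpre.
- apply/trivIsetP => /= i j _ _ ij; rewrite -preimage_setI.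
  by move/trivIsetP : tF => /(_ _ _ _ _ ij) ->//; rewrite preimage_set0.
- by rewrite -preimage_bigcup; exact: mpre.
Qed.

HB.instance Definition _ := isMeasure.Build _ _ _ lebesgue_step
  step0 step_ge0 step_sigma_additive.

Let step_sigma_finite : sigma_finite setT lebesgue_step.
Proof.
have /sigma_finiteP[F [TF ndF Foo]] :=
  sigma_finiteT (lebesgue_measure : {sigma_finite_measure set (measurableTypeR R) -> \bar R}).
have /sigma_finiteP[G [TG ndG Goo]] := sigma_finiteT mu.
exists (fun k => @unconsv n @^-1` (F k `*` G k)).
  rewrite -preimage_bigcup (_ : \bigcup_k _ = setT) ?preimage_setT//.
  apply/seteqP; split=> // -[x y] _.
  have : setT x by []. rewrite TF => -[k _ Fx].
  have : setT y by []. rewrite TG => -[l _ Gy].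
  exists (maxn k l) => //; split.
  - by move: x Fx; exact/subsetPset/ndF/leq_maxl.
  - by move: y Gy; exact/subsetPset/ndG/leq_maxr.
move=> k; have [mF Fk] := Foo k; have [mG Gk] := Goo k; split.
  rewrite -[X in measurable X]setTI; apply: measurable_unconsv => //.
  exact: measurableX.
rewrite /lebesgue_step -comp_preimage (_ : _ \o _ = id); last first.
  by apply/funext => z; exact: consvK.
by rewrite preimage_id product_measure1E// lte_mul_pinfty// ge0_fin_numE.
Qed.

HB.instance Definition _ := Measure_isSigmaFinite.Build _ _ _ lebesgue_step
  step_sigma_finite.

End step.

Fixpoint lebesgue_cV (n : nat) : {sigma_finite_measure set 'cV[R]_n -> \bar R} :=
  match n with
  | 0 => \d_(0 : 'cV[R]_0)
  | k.+1 => lebesgue_step (lebesgue_cV k)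
  end.

End lebesgue_measure_cV.

Section euclidean.
Context {R : realType}.

Definition dot n (u v : 'cV[R]_n) : R := \sum_i u i 0 * v i 0.

(* the library norm `|x| on matrices is the sup norm, hence this one *)
Definition enorm n (x : 'cV[R]_n) : R := Num.sqrt (dot x x).

Definition spd n (S : 'M[R]_n) : Prop :=
  S^T = S /\ forall x : 'cV[R]_n, x != 0 -> 0 < dot x (S *m x).

Definition range_orthocomp m n (A : 'M[R]_(m, n)) : set 'cV[R]_m :=
  [set w | forall x : 'cV[R]_n, dot w (A *m x) = 0].

Definition is_orthoproj m (Q : 'M[R]_m) (W : set 'cV[R]_m) : Prop :=
  forall y : 'cV[R]_m,
    W (Q *m y) /\ forall w, W w -> dot w (y - Q *m y) = 0.

(* density of N(0, S) *)
Definition gaussian_pdf n (S : 'M[R]_n) (x : 'cV[R]_n) : R :=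
  expR (- dot x (invmx S *m x) / 2) / Num.sqrt ((2 * pi) ^+ n * \det S).

(* exp(-|y|^2/2), the likelihood of the residual y up to a constant *)
Definition gauss_likelihood m (y : 'cV[R]_m) : R :=
  expR (- (enorm y ^+ 2) / 2).

End euclidean.

Section random_vectors.
Context {R : realType} {d : measure_display} {Omega : measurableType d}
  (P : probability Omega R).

Definition has_density n (X : {RV P >-> 'cV[R]_n}) (f : 'cV[R]_n -> R) : Prop :=
  forall A, measurable A ->
    distribution P X A = (\int[lebesgue_cV n]_(x in A) (f x)%:E)%E.

Definition independent d1 d2 (T1 : measurableType d1) (T2 : measurableType d2)
    (X : Omega -> T1) (Y : Omega -> T2) : Prop :=
  forall A B, measurable A -> measurable B ->
    P (X @^-1` A `&` Y @^-1` B) = (P (X @^-1` A) * P (Y @^-1` B))%E.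

(* p x1 x2 b is a conditional density of (X1, X2) given B = b: each
   p(., . | b) is a probability density, and these are a regular
   conditional distribution of (X1, X2) given B *)
Definition is_cond_density n1 n2 m (X1 : Omega -> 'cV[R]_n1)
    (X2 : Omega -> 'cV[R]_n2) (B : Omega -> 'cV[R]_m)
    (p : 'cV[R]_n1 -> 'cV[R]_n2 -> 'cV[R]_m -> R) : Prop :=
  let leb := (lebesgue_cV n1 \x lebesgue_cV n2)%E in
  [/\ measurable_fun setT
        (fun z : 'cV[R]_n1 * 'cV[R]_n2 * 'cV[R]_m => p z.1.1 z.1.2 z.2),
      forall x1 x2 b, 0 <= p x1 x2 b,
      forall b, (\int[leb]_x (p x.1 x.2 b)%:E = 1)%E
    & forall S T, measurable S -> measurable T ->
        P ((fun w => (X1 w, X2 w)) @^-1` S `&` B @^-1` T) =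
        (\int[P]_(w in B @^-1` T) \int[leb]_(x in S) (p x.1 x.2 (B w))%:E)%E].

End random_vectors.

Section posteriors.
Context {R : realType} (m n1 n2 : nat).

Definition marginal1 (p : 'cV[R]_n1 -> 'cV[R]_n2 -> 'cV[R]_m -> R)
    (x1 : 'cV[R]_n1) (b : 'cV[R]_m) : \bar R :=
  (\int[lebesgue_cV n2]_x2 (p x1 x2 b)%:E)%E.

Definition projected_likelihood (Pperp : 'M[R]_m) (A1 : 'M[R]_(m, n1))
    (b : 'cV[R]_m) (x1 : 'cV[R]_n1) : R :=
  gauss_likelihood (Pperp *m b - (Pperp *m A1) *m x1).

Definition projected_posterior (Gamma : 'M[R]_n1) (Pperp : 'M[R]_m)
    (A1 : 'M[R]_(m, n1)) (b : 'cV[R]_m) (x1 : 'cV[R]_n1) : R :=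
  let f x := gaussian_pdf Gamma x * projected_likelihood Pperp A1 b x in
  f x1 / fine (\int[lebesgue_cV n1]_x (f x)%:E)%E.

End posteriors.

(* Main.v *)
From HB Require Import structures.
Require Import Defs.
From mathcomp Require Import all_boot all_order all_algebra.
From mathcomp Require Import all_classical all_reals all_analysis.
From mathcomp Require Import measurable_realfun ring.
Import Order.TTheory GRing.Theory Num.Theory.
Import numFieldTopology.Exports numFieldNormedType.Exports.
Local Open Scope classical_set_scope.
Local Open Scope ring_scope.

Set Implicit Arguments.
Unset Strict Implicit.

(** Write [q x2 = x2^T G^-1 x2] and let [g] be the prior density of [X1].  The
prior density of [X2] is [a^n2 exp(-a^2 q x2 / 2)] up to a constant
(gaussian_pdf_scale), so that [a^-n2] times the unnormalized marginal of [X1]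
is, up to that constant, the integral over [x2] of the flat weight
[g x1 exp(-|b - A1 x1 - A2 x2|^2 / 2)] damped by the factor
[exp(-a^2 q x2 / 2)].  This factor is at most 1 and tends to 1 as [a] tends
to 0, hence by dominated convergence (cvg_integral_damped) the damping
disappears in the limit as soon as the flat weight is integrable.

The integral of the flat weight over [x2] is explicit.  With [r = b - A1 x1]
and [Q] the orthogonal projector, [r - Q r = A2 y] for some [y], and Pythagoras
gives [|r - A2 x2|^2 = |Q r|^2 + |A2 (x2 - y)|^2] (orthoproj_pythagoras).  By
translation invariance of Lebesgue measure the integral is
[exp(-|Q r|^2 / 2) V], where [V], the integral of [exp(-|A2 x|^2 / 2)], does
not depend on [x1] (integral_gauss_likelihood_residual); it is finite because
the injectivity of [A2] makes [|A2 x|^2] dominate a multiple of [|x|^2].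
The first factor is the likelihood of the projected problem, which proves the
scaled limit.

For the normalized marginals, the same dominated convergence is applied to the
flat weight on [R^n1 x R^n2], which is integrable since its integral over [x2]
is at most [V g x1].  As each posterior density has mass 1, this controls the
normalizing constant: the marginal is the quotient of a damped integral over
[x2] by the damped integral over [(x1, x2)], and both have positive finite
limits in which [V] cancels. *)

(** * Euclidean algebra of column vectors *)

Section dot_algebra.
Context {R : realType}.

Lemma dotE n (u v : 'cV[R]_n) : dot u v = (u^T *m v) 0 0.
Proof. by rewrite mxE; apply: eq_bigr => i _; rewrite mxE. Qed.

Lemma dotC n (u v : 'cV[R]_n) : dot u v = dot v u.
Proof. by apply: eq_bigr => i _; rewrite mulrC. Qed.

Lemma dotBl n (u v w : 'cV[R]_n) : dot (u - v) w = dot u w - dot v w.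
Proof. by rewrite !dotE linearB mulmxBl !mxE. Qed.

Lemma dotBr n (u v w : 'cV[R]_n) : dot u (v - w) = dot u v - dot u w.
Proof. by rewrite dotC dotBl !(dotC u). Qed.

Lemma dot_mulmx m n (A : 'M[R]_(m, n)) u v : dot u (A *m v) = dot (A^T *m u) v.
Proof. by rewrite !dotE trmx_mul trmxK mulmxA. Qed.

Lemma dot_ge0 n (v : 'cV[R]_n) : 0 <= dot v v.
Proof. by apply: sumr_ge0 => i _; exact: sqr_ge0. Qed.

Lemma dot_eq0 n (v : 'cV[R]_n) : dot v v = 0 -> v = 0.
Proof.
move=> /eqP; rewrite psumr_eq0; last by move=> i _; exact: sqr_ge0.
move=> /allP v0; apply/matrixP => i j; rewrite ord1 mxE.
have := v0 i (mem_index_enum i).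
by rewrite mulf_eq0 orbb => /eqP.
Qed.

Lemma inj_unitmx n (M : 'M[R]_n) :
  (forall x : 'cV[R]_n, M *m x = 0 -> x = 0) -> M \in unitmx.
Proof.
move=> injM; rewrite -unitmx_tr -row_free_unit; apply/inj_row_free => v vM0.
apply: trmx_inj; rewrite trmx0; apply: injM.
by rewrite -[M]trmxK -trmx_mul vM0 trmx0.
Qed.

(** Every entry of [x] is at most [|x|] in absolute value, so entry [i] of
[A *m x] is at most [|x|] times the l1 norm of row [i]; the summand 1 keeps the
constant positive when [A] vanishes. *)
Lemma dot_mulmx_le m n (A : 'M[R]_(m, n)) :
  exists2 c, 0 < c & forall x, dot (A *m x) (A *m x) <= c * dot x x.
Proof.
exists (1 + \sum_i (\sum_j `|A i j|) ^+ 2).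
  by rewrite ltr_pwDl // sumr_ge0// => i _; exact: sqr_ge0.
move=> x; rewrite mulrDl mul1r mulr_suml; apply: ler_wpDl; first exact: dot_ge0.
apply: ler_sum => i _; rewrite -expr2 -(sqr_sqrtr (dot_ge0 x)) -exprMn.
rewrite -[leLHS](real_normK (num_real _)).
rewrite ler_pXn2r ?nnegrE ?normr_ge0 ?mulr_ge0 ?sqrtr_ge0 ?sumr_ge0// mxE.
apply: (le_trans (ler_norm_sum _ _ _)); rewrite mulr_suml.
apply: ler_sum => j _; rewrite normrM ler_wpM2l//.
rewrite -sqrtr_sqr ler_wsqrtr// /dot (bigD1 j)//= -expr2 lerDl.
by apply: sumr_ge0 => k _; exact: sqr_ge0.
Qed.

(** A full column rank matrix has a left inverse, and bounding the latter from
above bounds the matrix from below. *)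
Lemma full_rank_dot_ge m n (A : 'M[R]_(m, n)) : \rank A = n ->
  exists2 c, 0 < c & forall x, c * dot x x <= dot (A *m x) (A *m x).
Proof.
move=> rA; have [c c0 cP] := dot_mulmx_le (pinvmx A).
exists c^-1; rewrite ?invr_gt0// => x; rewrite mulrC ler_pdivrMr// mulrC.
by apply: le_trans (cP (A *m x)); rewrite mulmxA mulVpmx ?mul1mx// /row_full rA.
Qed.

Lemma gram_unitmx m n (A : 'M[R]_(m, n)) : \rank A = n -> A^T *m A \in unitmx.
Proof.
move=> rA; apply: inj_unitmx => x Ax0; apply: dot_eq0.
have [c c0 cP] := full_rank_dot_ge rA.
have := cP x; rewrite dot_mulmx mulmxA Ax0.
rewrite [X in _ <= X -> _](_ : _ = 0); last first.
  by rewrite /dot big1 // => i _; rewrite mxE mul0r.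
rewrite pmulr_rle0// => x0; apply/eqP; rewrite eq_le x0; exact: dot_ge0.
Qed.

(** The normal equations produce [A *m y] with [r - A *m y] orthogonal to the
range of [A]; since the projection also has an orthogonal residual, the two
approximations of [r] differ by a vector orthogonal to itself. *)
Lemma orthoproj_residual m n (A : 'M[R]_(m, n)) (Q : 'M[R]_m) : \rank A = n ->
  is_orthoproj Q (range_orthocomp A) ->
  forall r, exists y : 'cV[R]_n, r - Q *m r = A *m y.
Proof.
move=> rA projQ r; have [Wr orthr] := projQ r.
pose y := invmx (A^T *m A) *m (A^T *m r).
have Wy : range_orthocomp A (r - A *m y).
  move=> x; rewrite dot_mulmx mulmxBr /y !mulmxA mulmxV ?gram_unitmx//.
  by rewrite mul1mx subrr /dot big1 // => i _; rewrite mxE mul0r.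
exists y; apply/eqP; rewrite -subr_eq0; apply/eqP/dot_eq0.
have Ww : range_orthocomp A (r - Q *m r - A *m y).
  by move=> x; rewrite addrAC dotBl Wy Wr subrr.
by rewrite dotBr (orthr _ Ww) Ww subrr.
Qed.

Lemma orthoproj_pythagoras m n (A : 'M[R]_(m, n)) (Q : 'M[R]_m) : \rank A = n ->
  is_orthoproj Q (range_orthocomp A) ->
  forall r, exists y : 'cV[R]_n, forall x, dot (r - A *m x) (r - A *m x) =
    dot (Q *m r) (Q *m r) + dot (A *m (x - y)) (A *m (x - y)).
Proof.
move=> rA projQ r; have [y ry] := orthoproj_residual rA projQ r.
exists y => x; have [Wr _] := projQ r.
have -> : r - A *m x = Q *m r - A *m (x - y).
  by rewrite mulmxBr -ry; apply/matrixP => i j; rewrite !mxE; ring.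
rewrite dotBl !dotBr (dotC (A *m _) (Q *m r)) !Wr.
by ring.
Qed.

Lemma spd_unitmx n (S : 'M[R]_n) : spd S -> S \in unitmx.
Proof.
move=> [_ Spos]; apply: inj_unitmx => z Sz0; apply/eqP/negPn/negP => z0.
by have := Spos _ z0; rewrite Sz0 /dot big1 ?ltxx // => i _; rewrite mxE mulr0.
Qed.

(** Substituting [x = S *m z] turns the form of the inverse into that of
[S]. *)
Lemma invmx_spd_ge0 n (S : 'M[R]_n) : spd S -> forall x, 0 <= dot x (invmx S *m x).
Proof.
move=> spdS x; rewrite -{1}[x](mulKVmx (spd_unitmx spdS)) dotC.
have [->|z0] := eqVneq (invmx S *m x) 0; first by rewrite mulmx0 dot_ge0.
exact/ltW/(proj2 spdS).
Qed.
End dot_algebra.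

(** * Lebesgue measure on column vectors *)

Section lebesgue_translation.
Context {R : realType}.
Local Open Scope ereal_scope.

(** A named function, rather than a lambda term, so that it can carry the
measurable function structure that [pushforward] looks up. *)
Definition translate (t x : measurableTypeR R) : measurableTypeR R := (x + t)%R.

Lemma measurable_translate t : measurable_fun setT (translate t).
Proof. exact: measurable_funD. Qed.

HB.instance Definition _ t :=
  isMeasurableFun.Build _ _ _ _ (translate t) (measurable_translate t).

Lemma lebesgue_measure_translate (t : R) (A : set (measurableTypeR R)) :
  measurable A ->
  lebesgue_measure A = pushforward lebesgue_measure (translate t) A.
Proof.
apply: lebesgue_measure_unique => // X [[a b] _ <-].
transitivity (lebesgue_measure (translate t @^-1` [set` `]a, b]])); last by [].
have -> : translate t @^-1` [set` `]a, b]] = `](a - t)%R, (b - t)%R]%classic.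
  by apply/seteqP; split => x /=; rewrite /translate !in_itv/= ltrBlDr lerBrDr.
rewrite !lebesgue_measure_itv /= !lte_fin ltrD2r; case: ifP => // _.
by rewrite -!EFinB; congr EFin; ring.
Qed.

Lemma ge0_integral_lebesgue_translate (t : R) (f : measurableTypeR R -> \bar R) :
  measurable_fun setT f -> (forall x, 0 <= f x) ->
  \int[lebesgue_measure]_x f (x + t)%R = \int[lebesgue_measure]_x f x.
Proof.
move=> mf f0.
rewrite [RHS](eq_measure_integral
  (pushforward lebesgue_measure (translate t))); last first.
  by move=> A mA _; exact: lebesgue_measure_translate.
by rewrite ge0_integral_pushforward //; exact: measurable_translate.
Qed.

End lebesgue_translation.

HB.instance Definition _ (R : realType) (n : nat) :=
  isMeasurableFun.Build _ _ _ _ (@consv R n) (measurable_consv (n := n)).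

Section lebesgue_cV_integral.
Context {R : realType}.
Local Open Scope ereal_scope.

Lemma measurable_cons_section (n : nat) (f : 'cV[R]_n.+1 -> \bar R) (t : R) :
  measurable_fun setT f -> measurable_fun setT (fun v => f (consv (t, v))).
Proof.
move=> mf; apply: (measurableT_comp mf).
apply: (measurableT_comp (measurable_consv (n := n))).
exact: measurable_fun_pair.
Qed.

Lemma ge0_integral_lebesgue_cVS (n : nat) (f : 'cV[R]_n.+1 -> \bar R) :
  measurable_fun setT f -> (forall v, 0 <= f v) ->
  \int[lebesgue_cV n.+1]_v f v =
  \int[lebesgue_measure]_t \int[lebesgue_cV n]_v f (consv (t, v)).
Proof.
move=> mf f0.
rewrite [LHS](eq_measure_integral
  (pushforward (lebesgue_measure \x lebesgue_cV n) (@consv R n))) //.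
  exact: measurable_consv.
move=> mc; rewrite ge0_integral_pushforward ?preimage_setT //.
rewrite fubini_tonelli1 //=.
by apply: measurableT_comp => //; exact: measurable_consv.
Qed.

Lemma measurable_integral_cons (n : nat) (f : 'cV[R]_n.+1 -> \bar R) :
  measurable_fun setT f -> (forall v, 0 <= f v) ->
  measurable_fun setT
    (fun t : measurableTypeR R => \int[lebesgue_cV n]_v f (consv (t, v))).
Proof.
move=> mf f0.
apply: (@measurable_fun_fubini_tonelli_F _ _ (measurableTypeR R) _ _
  (lebesgue_cV n) (f \o @consv R n)); last by move=> x; exact: f0.
  by apply: measurableT_comp => //; exact: measurable_consv.
Qed.

Lemma consvD (n : nat) (t : R) (v : 'cV[R]_n) (w : 'cV[R]_n.+1) :
  (consv (t, v) + w)%R = consv (t + (unconsv w).1, v + (unconsv w).2)%R.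
Proof.
have ew : w = consv (unconsv w).
  apply/matrixP => i j; rewrite ord1 /consv/=.
  have [k ik|k ik] := split_ordP (i : 'I_(1 + n)).
  - rewrite ik; transitivity (w (lshift n k) ord0) => //.
    rewrite (col_mxEu (const_mx _ : 'cV_1)) mxE; congr (w _ _).
    by apply/val_inj; rewrite /= ord1.
  - rewrite ik; transitivity (dsubmx (w : 'cV_(1 + n)) k ord0); first by rewrite mxE.
    exact/esym/col_mxEd.
rewrite {1}ew /consv/=.
rewrite (_ : const_mx (t + _)%R = (const_mx t + const_mx (w ord0 ord0))%R);
  last first.
  by apply/matrixP => i j; rewrite !mxE.
exact: (add_col_mx (const_mx t : 'cV_1) v _ (dsubmx (w : 'cV_(1 + n)))).
Qed.

Lemma measurable_cV_translate (n : nat) (w : 'cV[R]_n) :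
  measurable_fun setT (fun v : 'cV[R]_n => (v + w)%R).
Proof.
apply: measurable_fun_mxP => i j.
under eq_fun do rewrite mxE.
by apply: measurable_funD => //; exact: measurable_mx_coord.
Qed.

(** Translate the tail of the vector by the induction hypothesis for each fixed
head, then the head by the one-dimensional invariance. *)
Lemma ge0_integral_lebesgue_cV_translate (n : nat) (w : 'cV[R]_n)
    (f : 'cV[R]_n -> \bar R) :
  measurable_fun setT f -> (forall v, 0 <= f v) ->
  \int[lebesgue_cV n]_v f (v + w)%R = \int[lebesgue_cV n]_v f v.
Proof.
elim: n => [|n IHn] in w f * => mf f0.
  by apply: eq_integral => v _; congr f; apply/matrixP => -[].
rewrite [LHS]ge0_integral_lebesgue_cVS //; last first.
  exact: (measurableT_comp mf (measurable_cV_translate w)).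
rewrite [RHS]ge0_integral_lebesgue_cVS //.
transitivity (\int[lebesgue_measure]_t
    \int[lebesgue_cV n]_v f (consv (t + (unconsv w).1, v)%R)).
  apply: eq_integral => t _.
  under eq_integral do rewrite consvD.
  apply: (IHn _ (fun v => f (consv ((t + (unconsv w).1)%R, v)))) => //.
  exact: measurable_cons_section.
apply: (ge0_integral_lebesgue_translate (unconsv w).1
  (f := fun t => \int[lebesgue_cV n]_v f (consv (t, v)))).
- exact: measurable_integral_cons.
- by move=> t; exact: integral_ge0.
Qed.

Lemma lebesgue_cV_setT_gt0 n : 0 < (lebesgue_cV n : set 'cV[R]_n -> _) setT.
Proof.
elim: n => [|n IHn].
  by rewrite [X in _ < X](_ : _ = 1) ?lte01//; exact: diracT.
rewrite /= /lebesgue_step preimage_setT -setXTT.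
rewrite product_measure1E// mule_gt0//.
apply: (@lt_le_trans _ _ (lebesgue_measure (`[0%R, 1%R]%classic : set R))).
  by rewrite lebesgue_measure_itv/= lte01 oppr0 adde0 lte01.
by apply: le_measure; rewrite ?inE.
Qed.

(** A vanishing integral would make the positive [f] vanish almost everywhere,
hence the whole space negligible. *)
Lemma integral_gt0 d (T : measurableType d) (mu : {measure set T -> \bar R})
    (f : T -> \bar R) :
  0 < mu setT -> measurable_fun setT f -> (forall x, 0 < f x) ->
  0 < \int[mu]_x f x.
Proof.
move=> mu0 mf f0; rewrite lt0e integral_ge0 ?andbT; last by move=> x _; exact: ltW.
apply/negP => /eqP fint.
have /(ae_eq_integral_abs _ _ mf) : \int[mu]_x `|f x| = 0.
  by rewrite -[RHS]fint; apply: eq_integral => x _; rewrite gee0_abs ?ltW.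
move=> [] // N [mN N0] sub.
move: mu0; rewrite (_ : setT = N) ?N0 ?ltxx//; apply/seteqP; split => // x _.
by apply: sub => /= /(_ I); apply/eqP; rewrite gt_eqF.
Qed.

End lebesgue_cV_integral.

(** * Measurability of vector expressions *)

Section measurable_vectors.
Context {R : realType} {d : measure_display} {T : measurableType d}.

Lemma measurable_mx_entry p q (f : T -> 'M[R]_(p, q)) i j :
  measurable_fun setT f -> measurable_fun setT (fun t => f t i j).
Proof. by move=> mf; exact: (measurableT_comp (measurable_mx_coord i j) mf). Qed.

Lemma measurable_mulmx m n p (A : 'M[R]_(m, n)) (f : T -> 'M[R]_(n, p)) :
  measurable_fun setT f -> measurable_fun setT (fun t => A *m f t).
Proof.
move=> mf; apply: measurable_fun_mxP => i j.
under eq_fun do rewrite mxE.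
apply: measurable_sum => k; apply: measurable_funM => //.
exact: measurable_mx_entry.
Qed.

Lemma measurable_mxB m n (f g : T -> 'M[R]_(m, n)) :
  measurable_fun setT f -> measurable_fun setT g ->
  measurable_fun setT (fun t => f t - g t).
Proof.
move=> mf mg; apply: measurable_fun_mxP => i j.
under eq_fun do rewrite !mxE.
by apply: measurable_funB; exact: measurable_mx_entry.
Qed.

Lemma measurable_dot n (f g : T -> 'cV[R]_n) :
  measurable_fun setT f -> measurable_fun setT g ->
  measurable_fun setT (fun t => dot (f t) (g t)).
Proof.
move=> mf mg; apply: measurable_sum => i.
by apply: measurable_funM; exact: measurable_mx_entry.
Qed.

Lemma measurable_gaussian_pdf n (S : 'M[R]_n) (f : T -> 'cV[R]_n) :
  measurable_fun setT f -> measurable_fun setT (fun t => gaussian_pdf S (f t)).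
Proof.
move=> mf; apply: measurable_funM => //.
apply: (measurableT_comp (@measurable_expR R)).
apply: measurable_funM => //; apply: measurable_funN.
by apply: measurable_dot => //; exact: measurable_mulmx.
Qed.

Lemma gauss_likelihoodE n (y : 'cV[R]_n) : gauss_likelihood y = expR (- dot y y / 2).
Proof.
by rewrite /gauss_likelihood sqr_sqrtr //; apply: sumr_ge0 => i _; exact: sqr_ge0.
Qed.

Lemma measurable_gauss_likelihood n (f : T -> 'cV[R]_n) :
  measurable_fun setT f -> measurable_fun setT (fun t => gauss_likelihood (f t)).
Proof.
move=> mf; under eq_fun do rewrite gauss_likelihoodE.
apply: (measurableT_comp (@measurable_expR R)).
by apply: measurable_funM => //; apply: measurable_funN; exact: measurable_dot.
Qed.

End measurable_vectors.

(** * Gaussian integrals and densities *)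

Section gauss_cV.
Context {R : realType}.
Local Open Scope ereal_scope.

Lemma dot_consv n t (v : 'cV[R]_n) :
  dot (consv (t, v)) (consv (t, v)) = (t ^+ 2 + dot v v)%R.
Proof.
rewrite /dot [LHS](@big_split_ord _ _ _ 1 n) big_ord1.
rewrite /consv !(col_mxEu (const_mx t : 'cV_1)) !mxE; congr (_ + _)%R.
by apply: eq_bigr => i _; rewrite !(col_mxEd (const_mx t : 'cV_1)).
Qed.

Lemma integral_expR_sqr_lty (c : R) : (0 < c)%R ->
  \int[lebesgue_measure]_t (expR (- (c * t ^+ 2)))%:E < +oo.
Proof.
(* the standard deviation s is such that s ^+ 2 *+ 2 = c^-1 *)
move=> c0; pose s := Num.sqrt (2 * c)^-1.
have s0 : s != 0%R by rewrite gt_eqF// sqrtr_gt0 invr_gt0 mulr_gt0.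
have fE t : expR (- (c * t ^+ 2)) = normal_fun 0 s t.
  rewrite /normal_fun subr0; congr expR.
  rewrite sqr_sqrtr ?invr_ge0 ?mulr_ge0 ?ltW//.
  by field; rewrite gt_eqF.
under eq_integral do rewrite fE.
have pE t : normal_pdf 0 s t = (normal_peak s * normal_fun 0 s t)%R.
  by rewrite normal_pdfE.
have : \int[lebesgue_measure]_t ((normal_peak s)%:E * (normal_fun 0 s t)%:E) = 1.
  rewrite -(integral_normal_pdf 0%R s).
  by apply: eq_integral => t _; rewrite pE EFinM.
rewrite ge0_integralZl_EFin//; last 3 first.
- by move=> t _; rewrite lee_fin normal_fun_ge0.
- by apply/measurable_EFinP; exact: measurable_normal_fun.
- exact: normal_peak_ge0.
rewrite [X in _ -> X < _](_ : _ = \int[lebesgue_measure]_t (normal_fun 0 s t)%:E)//.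
case: (\int[_]_t _) => [r _||]; first exact: ltry.
- by rewrite gt0_muley ?lte_fin ?normal_peak_gt0.
- by [].
Qed.

(** Along [consv] the Gaussian factors into a one-dimensional Gaussian in the
head and a Gaussian in the tail. *)
Lemma integral_expR_dot_lty n (c : R) : (0 < c)%R ->
  \int[lebesgue_cV n]_v (expR (- (c * dot v v)))%:E < +oo.
Proof.
move=> c0.
have mf k : measurable_fun setT (fun v : 'cV[R]_k => (expR (- (c * dot v v)))%:E).
  apply/measurable_EFinP; apply: (measurableT_comp (@measurable_expR R)).
  by apply: measurable_funN; apply: measurable_funM => //; exact: measurable_dot.
elim: n => [|n IHn].
  rewrite /= integral_dirac //; last exact: (mf 0%N).
  by rewrite [X in X * _](_ : _ = 1) ?mul1e ?ltry//; exact: diracT.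
rewrite ge0_integral_lebesgue_cVS; last 2 first.
- exact: mf.
- by move=> v; rewrite lee_fin expR_ge0.
rewrite (eq_integral (fun t : measurableTypeR R => (expR (- (c * t ^+ 2)))%:E *
    \int[lebesgue_cV n]_v (expR (- (c * dot v v)))%:E)); last first.
  move=> t _; under eq_integral do rewrite dot_consv mulrDr opprD expRD EFinM.
  rewrite ge0_integralZl_EFin ?expR_ge0//; first exact: mf.
rewrite /= ge0_integralZr//.
- apply: lte_mul_pinfty => //.
  + by apply: integral_ge0 => t _; rewrite lee_fin expR_ge0.
  + rewrite ge0_fin_numE ?integral_expR_sqr_lty//.
    by apply: integral_ge0 => t _; rewrite lee_fin expR_ge0.
- apply/measurable_EFinP; apply: (measurableT_comp (@measurable_expR R)).
  by apply: measurable_funN; apply: measurable_funM => //; exact: measurable_funX.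
- by apply: integral_ge0 => t _; rewrite lee_fin expR_ge0.
Qed.

End gauss_cV.

Section pdf.
Context {R : realType}.

Lemma gaussian_pdf_scale n (S : 'M[R]_n) (a : R) x : S \in unitmx -> 0 < a ->
  gaussian_pdf (a ^- 2 *: S) x =
  a ^+ n * (expR (- (a ^+ 2 * dot x (invmx S *m x)) / 2) /
            Num.sqrt ((2 * pi) ^+ n * \det S)).
Proof.
move=> uS a0; have ua : a ^- 2 \is a GRing.unit.
  by rewrite unitfE invr_eq0 expf_neq0 ?gt_eqF.
rewrite /gaussian_pdf detZ.
rewrite mulrCA sqrtrM ?exprn_ge0 ?invr_ge0 ?sqr_ge0//.
rewrite exprVn -exprM mulnC exprM sqrtrV ?sqr_ge0// sqrtr_sqr.
rewrite ger0_norm ?exprn_ge0 ?ltW//.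
rewrite [(_ ^- n * _)^-1]invfM invrK mulrCA; congr (_ * (expR _ / _)).
rewrite invmxZ; last by rewrite unitmxZ.
congr (- _ / _).
rewrite -scalemxAl !dotE -scalemxAr mxE invrK //.
Qed.

(** If the normalizing factor were 0, division by it would make the density
vanish identically, contradicting total mass 1.  In particular [\det S] is positive. *)
Lemma has_gaussian_density_gt0 d (Omega : measurableType d)
    (P : probability Omega R) n (X : {RV P >-> 'cV[R]_n}) (S : 'M[R]_n) :
  has_density X (gaussian_pdf S) ->
  0 < Num.sqrt ((2 * pi) ^+ n * \det S).
Proof.
move=> lawX; rewrite lt0r sqrtr_ge0 andbT; apply/eqP => s0.
have := lawX setT measurableT; rewrite probability_setT.
rewrite integral0_eq; first by move=> /eqP; rewrite onee_eq0.
by move=> x _; rewrite /gaussian_pdf s0 invr0 mulr0.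
Qed.

End pdf.

Section likelihood_integral.
Context {R : realType} (m n : nat) (A : 'M[R]_(m, n)).
Hypothesis rA : \rank A = n.
Local Open Scope ereal_scope.

Lemma gauss_likelihood_gt0 k (y : 'cV[R]_k) : (0 < gauss_likelihood y)%R.
Proof. exact: expR_gt0. Qed.

Lemma gauss_likelihood_le1 k (y : 'cV[R]_k) : (gauss_likelihood y <= 1)%R.
Proof.
by rewrite gauss_likelihoodE -[leRHS]expR0 ler_expR mulNr oppr_le0 divr_ge0 ?dot_ge0.
Qed.

Lemma measurable_gauss_likelihood_mulmx :
  measurable_fun setT (fun x => (gauss_likelihood (A *m x))%:E).
Proof.
by apply/measurable_EFinP/measurable_gauss_likelihood; exact: measurable_mulmx.
Qed.

Lemma integral_gauss_likelihood_lty :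
  \int[lebesgue_cV n]_x (gauss_likelihood (A *m x))%:E < +oo.
Proof.
have [c c0 cP] := full_rank_dot_ge rA.
apply: le_lt_trans (integral_expR_dot_lty n (c := c / 2) _);
  last by rewrite divr_gt0.
apply: ge0_le_integral => //.
- by move=> x _; rewrite lee_fin ltW ?gauss_likelihood_gt0.
- exact: measurable_gauss_likelihood_mulmx.
- apply/measurable_EFinP; apply: (measurableT_comp (@measurable_expR R)).
  by apply: measurable_funN; apply: measurable_funM => //; exact: measurable_dot.
- move=> x _; rewrite lee_fin gauss_likelihoodE ler_expR mulNr lerN2 mulrAC.
  by rewrite ler_wpM2r.
Qed.

Lemma integral_gauss_likelihood_gt0 :
  0 < \int[lebesgue_cV n]_x (gauss_likelihood (A *m x))%:E.
Proof.
apply: integral_gt0; first exact: lebesgue_cV_setT_gt0.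
- exact: measurable_gauss_likelihood_mulmx.
- by move=> x; rewrite lte_fin gauss_likelihood_gt0.
Qed.

(** By Pythagoras the likelihood of [r - A *m x] is that of [Q *m r] times that
of [A *m (x - y)], and translation by [y] removes the dependence on [r] of the
second factor. *)
Lemma integral_gauss_likelihood_residual (Q : 'M[R]_m) (r : 'cV[R]_m) :
  is_orthoproj Q (range_orthocomp A) ->
  \int[lebesgue_cV n]_x (gauss_likelihood (r - A *m x))%:E =
  (gauss_likelihood (Q *m r))%:E *
    \int[lebesgue_cV n]_x (gauss_likelihood (A *m x))%:E.
Proof.
move=> projQ; have [y yP] := orthoproj_pythagoras rA projQ r.
rewrite -[in RHS](ge0_integral_lebesgue_cV_translate (- y)
  (f := fun x => (gauss_likelihood (A *m x))%:E)); last 2 first.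
- exact: measurable_gauss_likelihood_mulmx.
- by move=> x; rewrite lee_fin ltW ?gauss_likelihood_gt0.
rewrite -ge0_integralZl_EFin//.
- apply: eq_integral => x _; rewrite !gauss_likelihoodE yP -EFinM -expRD.
  by congr (expR _)%:E; rewrite -mulrDl opprD.
- by move=> x _; rewrite lee_fin ltW ?gauss_likelihood_gt0.
- exact: (measurableT_comp measurable_gauss_likelihood_mulmx
    (measurable_cV_translate (- y))).
- by rewrite ltW ?gauss_likelihood_gt0.
Qed.

End likelihood_integral.

(** * The uninformative limit *)

Section dominated.
Context {R : realType}.

(** The undamped [h] itself is the dominating function. *)
Lemma cvg_integral_damped d (T : measurableType d) (mu : {measure set T -> \bar R})
    (q h : T -> R) (u : R^nat) :
  measurable_fun setT q -> measurable_fun setT h ->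
  (forall x, 0 <= q x) -> (forall x, 0 <= h x) ->
  (\int[mu]_x (h x)%:E < +oo)%E -> u n @[n --> \oo] --> 0 ->
  (\int[mu]_x (expR (- (u n ^+ 2 * q x) / 2) * h x)%:E)%E @[n --> \oo] -->
  (\int[mu]_x (h x)%:E)%E.
Proof.
move=> mq mh q0 h0 hoo u0.
have damp_le1 n x : expR (- (u n ^+ 2 * q x) / 2) <= 1.
  by rewrite -expR0 ler_expR mulNr oppr_le0 divr_ge0// mulr_ge0 ?sqr_ge0.
apply: (@dominated_cvg _ _ _ mu setT measurableT
  (fun n x => (expR (- (u n ^+ 2 * q x) / 2) * h x)%:E)
  (fun x => (h x)%:E) (fun x => (h x)%:E)).
- move=> n; apply/measurable_EFinP; apply: measurable_funM => //.
  apply: (measurableT_comp (@measurable_expR R)).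
  apply: measurable_funM => //; apply: measurable_funN.
  exact: measurable_funM.
- move=> x _; apply: cvg_EFin; first exact: nearW.
  rewrite [X in _ --> X](_ : _ = expR (- (0 ^+ 2 * q x) / 2) * h x); last first.
    by rewrite expr0n/= mul0r oppr0 mul0r expR0 mul1r.
  apply: cvgMr_tmp; apply: continuous_cvg; first exact: continuous_expR.
  exact: (cvgMr_tmp (cvgN (cvgMr_tmp (cvgM u0 u0)))).
- by [].
- apply/integrableP; split; first exact/measurable_EFinP.
  by under eq_integral do rewrite gee0_abs ?lee_fin//.
- move=> n x _; rewrite gee0_abs ?lee_fin ?mulr_ge0 ?expR_ge0//.
  by rewrite ler_piMl.
Qed.

End dominated.

Section uninformative_limit.
Context {R : realType} (m n1 n2 : nat) (A1 : 'M[R]_(m, n1)) (A2 : 'M[R]_(m, n2)).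
Variables (Gamma : 'M[R]_n1) (G : 'M[R]_n2) (Q : 'M[R]_m) (b : 'cV[R]_m).
Hypothesis rankA2 : \rank A2 = n2.
Hypothesis spdG : spd G.
Hypothesis projQ : is_orthoproj Q (range_orthocomp A2).
Hypothesis prior_mass : (\int[lebesgue_cV n1]_x (gaussian_pdf Gamma x)%:E = 1)%E.
Hypothesis prior_gt0 : forall x, 0 < gaussian_pdf Gamma x.

Let q (x2 : 'cV[R]_n2) := dot x2 (invmx G *m x2).

(** The unnormalized posterior density of [(X1, X2)] at the observation [b] for
the improper uniform prior on [X2]. *)
Definition flat_weight (x : 'cV[R]_n1 * 'cV[R]_n2) : R :=
  gaussian_pdf Gamma x.1 * gauss_likelihood (b - A1 *m x.1 - A2 *m x.2).

(** The unnormalized posterior density for the prior of scale [a] on [X2],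
without the factor [a ^+ n2] and the constant of that prior. *)
Definition damped_weight (a : R) (x : 'cV[R]_n1 * 'cV[R]_n2) : R :=
  expR (- (a ^+ 2 * q x.2) / 2) * flat_weight x.

Definition projected_weight (x1 : 'cV[R]_n1) : R :=
  gaussian_pdf Gamma x1 * projected_likelihood Q A1 b x1.

Definition nuisance_volume : R :=
  fine (\int[lebesgue_cV n2]_x (gauss_likelihood (A2 *m x))%:E)%E.

Lemma nuisance_volumeE :
  (\int[lebesgue_cV n2]_x (gauss_likelihood (A2 *m x))%:E = nuisance_volume%:E)%E.
Proof.
rewrite fineK// ge0_fin_numE; first exact: integral_gauss_likelihood_lty.
exact/ltW/integral_gauss_likelihood_gt0.
Qed.

Lemma nuisance_volume_gt0 : 0 < nuisance_volume.
Proof.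
by rewrite -lte_fin -nuisance_volumeE; exact: integral_gauss_likelihood_gt0.
Qed.

Lemma flat_weight_ge0 x : 0 <= flat_weight x.
Proof. by rewrite mulr_ge0 ?ltW ?prior_gt0 ?gauss_likelihood_gt0. Qed.

Lemma projected_weight_gt0 x : 0 < projected_weight x.
Proof. by rewrite mulr_gt0 ?prior_gt0 ?gauss_likelihood_gt0. Qed.

Lemma measurable_flat_weight : measurable_fun setT flat_weight.
Proof.
apply: measurable_funM; first exact: measurable_gaussian_pdf.
apply: measurable_gauss_likelihood; apply: measurable_mxB.
  by apply: measurable_mxB => //; exact: measurable_mulmx.
exact: measurable_mulmx.
Qed.

Lemma measurable_projected_weight : measurable_fun setT projected_weight.
Proof.
apply: measurable_funM; first exact: measurable_gaussian_pdf.
apply: measurable_gauss_likelihood; apply: measurable_mxB => //.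
exact: measurable_mulmx.
Qed.

Lemma integral_flat_weight x1 :
  (\int[lebesgue_cV n2]_x2 (flat_weight (x1, x2))%:E =
   (projected_weight x1 * nuisance_volume)%:E)%E.
Proof.
under eq_integral do rewrite /flat_weight/= EFinM.
rewrite ge0_integralZl_EFin//; last 3 first.
- by move=> x2 _; rewrite lee_fin ltW ?gauss_likelihood_gt0.
- apply/measurable_EFinP/measurable_gauss_likelihood; apply: measurable_mxB => //.
  exact: measurable_mulmx.
- exact/ltW/prior_gt0.
rewrite (integral_gauss_likelihood_residual rankA2 _ projQ) nuisance_volumeE.
by rewrite -!EFinM /projected_weight /projected_likelihood mulmxBr !mulmxA mulrA.
Qed.

Lemma projected_mass_gt0 : (0 < \int[lebesgue_cV n1]_x (projected_weight x)%:E)%E.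
Proof.
apply: integral_gt0; first exact: lebesgue_cV_setT_gt0.
- by apply/measurable_EFinP; exact: measurable_projected_weight.
- by move=> x; rewrite lte_fin projected_weight_gt0.
Qed.

(** The likelihood is at most 1, so the prior of [X1] dominates. *)
Lemma projected_mass_fin_num :
  (\int[lebesgue_cV n1]_x (projected_weight x)%:E)%E \is a fin_num.
Proof.
rewrite ge0_fin_numE ?ltW ?projected_mass_gt0//.
apply: (@le_lt_trans _ _ (\int[lebesgue_cV n1]_x (gaussian_pdf Gamma x)%:E)%E).
  apply: ge0_le_integral => //.
  - by move=> x _; rewrite lee_fin ltW ?projected_weight_gt0.
  - by apply/measurable_EFinP; exact: measurable_projected_weight.
  - by apply/measurable_EFinP; exact: measurable_gaussian_pdf.
  - move=> x _; rewrite lee_fin; apply: ler_piMr; first exact/ltW/prior_gt0.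
    exact: gauss_likelihood_le1.
by rewrite prior_mass ltry.
Qed.

Lemma integral2_flat_weight :
  (\int[lebesgue_cV n1 \x lebesgue_cV n2]_x (flat_weight x)%:E =
   (fine (\int[lebesgue_cV n1]_x (projected_weight x)%:E) * nuisance_volume)%:E)%E.
Proof.
rewrite fubini_tonelli1/=; last 2 first.
- by apply/measurable_EFinP; exact: measurable_flat_weight.
- by move=> x; rewrite lee_fin flat_weight_ge0.
rewrite EFinM fineK ?projected_mass_fin_num// -ge0_integralZr//.
- by apply: eq_integral => x1 _; rewrite /fubini_F integral_flat_weight.
- by apply/measurable_EFinP; exact: measurable_projected_weight.
- by move=> x _; rewrite lee_fin ltW ?projected_weight_gt0.
- by rewrite lee_fin ltW ?nuisance_volume_gt0.
Qed.

Lemma measurable_precision : measurable_fun setT q.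
Proof. by apply: measurable_dot => //; exact: measurable_mulmx. Qed.

Lemma cvg_integral_damped_weight (u : R^nat) x1 : u n @[n --> \oo] --> 0 ->
  (\int[lebesgue_cV n2]_x2 (damped_weight (u n) (x1, x2))%:E)%E @[n --> \oo] -->
  (projected_weight x1 * nuisance_volume)%:E.
Proof.
move=> u0; rewrite -integral_flat_weight.
apply: (cvg_integral_damped (q := q) (h := fun x2 => flat_weight (x1, x2))) => //.
- exact: measurable_precision.
- apply: (measurableT_comp measurable_flat_weight); exact: measurable_fun_pair.
- exact: invmx_spd_ge0.
- by move=> x2; exact: flat_weight_ge0.
- by rewrite integral_flat_weight ltry.
Qed.

Lemma cvg_integral2_damped_weight (u : R^nat) : u n @[n --> \oo] --> 0 ->
  (\int[lebesgue_cV n1 \x lebesgue_cV n2]_x (damped_weight (u n) x)%:E)%E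
    @[n --> \oo] -->
  (fine (\int[lebesgue_cV n1]_x (projected_weight x)%:E)%E * nuisance_volume)%:E.
Proof.
move=> u0; rewrite -integral2_flat_weight.
apply: (cvg_integral_damped (q := q \o snd) (h := flat_weight)) => //.
- exact: (measurableT_comp measurable_precision).
- exact: measurable_flat_weight.
- by move=> x; exact: invmx_spd_ge0.
- exact: flat_weight_ge0.
- by rewrite integral2_flat_weight ltry.
Qed.

End uninformative_limit.

Unset Implicit Arguments.
Set Strict Implicit.

(* Z a b is the normalizing constant left implicit in the formula
   post(x1, x2 | b) ~ prior(x1) prior_a(x2) exp(-|b - A1 x1 - A2 x2|^2 / 2).
   The normalized marginals converge to the normalized projected posterior;
   the limit scaled by a^-n2 is that of the marginal with Z a b not divided
   out, since the normalized one would diverge for n2 > 0. *)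
Theorem theorem3p2 (R : realType) (m n1 n2 : nat)
    (A1 : 'M[R]_(m, n1)) (A2 : 'M[R]_(m, n2))
    (rankA2 : \rank A2 = n2) (lt_n2_m : (n2 < m)%N)
    (Gamma : 'M[R]_n1) (spdGamma : spd Gamma)
    (G : 'M[R]_n2) (spdG : spd G)
    (d : measure_display) (Omega : measurableType d) (P : probability Omega R)
    (X1 : {RV P >-> 'cV[R]_n1}) (X2 : R -> {RV P >-> 'cV[R]_n2})
    (E : {RV P >-> 'cV[R]_m})
    (lawX1 : has_density X1 (gaussian_pdf Gamma))
    (lawX2 : forall a : R, 0 < a ->
      has_density (X2 a) (gaussian_pdf (a ^- 2 *: G)))
    (lawE : has_density E (gaussian_pdf 1%:M))
    (indepX : forall a : R, 0 < a -> independent P X1 (X2 a))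
    (indepE : forall a : R, 0 < a ->
      independent P (fun w => (X1 w, X2 a w)) E)
    (post : R -> 'cV[R]_n1 -> 'cV[R]_n2 -> 'cV[R]_m -> R)
    (condpost : forall a : R, 0 < a ->
      is_cond_density P X1 (X2 a)
        (fun w => A1 *m X1 w + A2 *m X2 a w + E w) (post a))
    (Z : R -> 'cV[R]_m -> R)
    (Z_gt0 : forall (a : R) (b : 'cV[R]_m), 0 < a -> 0 < Z a b)
    (bayes : forall (a : R) x1 x2 b, 0 < a ->
      post a x1 x2 b =
        (Z a b)^-1 * (gaussian_pdf Gamma x1 * gaussian_pdf (a ^- 2 *: G) x2
                      * gauss_likelihood (b - A1 *m x1 - A2 *m x2)))
    (Pperp : 'M[R]_m) (projPperp : is_orthoproj Pperp (range_orthocomp A2))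
    (b : 'cV[R]_m) :
  (forall x1 : 'cV[R]_n1,
     marginal1 (post a) x1 b @[a --> 0^'+] -->
     (projected_posterior Gamma Pperp A1 b x1)%:E)
  /\
  exists2 C : R, 0 < C &
    forall x1 : 'cV[R]_n1,
      ((a ^- n2 * Z a b)%:E * marginal1 (post a) x1 b)%E @[a --> 0^'+] -->
      (C * (gaussian_pdf Gamma x1 * projected_likelihood Pperp A1 b x1))%:E.
Proof.
have detG : 0 < Num.sqrt ((2 * pi) ^+ n2 * \det G).
  have := has_gaussian_density_gt0 (lawX2 1 ltr01).
  by rewrite expr1n invr1 scale1r.
have detGamma := has_gaussian_density_gt0 lawX1.
set kG := Num.sqrt _ in detG.
have prior_gt0 x : 0 < gaussian_pdf Gamma x by rewrite divr_gt0 ?expR_gt0.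
have prior_mass : (\int[lebesgue_cV n1]_x (gaussian_pdf Gamma x)%:E = 1)%E.
  by rewrite -(lawX1 setT measurableT) probability_setT.
pose V := nuisance_volume A2.
have V0 : 0 < V by exact: nuisance_volume_gt0.
pose F := fine (\int[lebesgue_cV n1]_x (projected_weight A1 Gamma Pperp b x)%:E)%E.
have F0 : 0 < F.
  apply: fine_gt0; rewrite projected_mass_gt0//=.
  by rewrite -ge0_fin_numE ?projected_mass_fin_num// ltW// projected_mass_gt0.
(* c a converts the damped weight into the posterior density *)
pose c a := a ^+ n2 / (kG * Z a b).
have c0 a : 0 < a -> 0 < c a.
  by move=> a0; rewrite divr_gt0 ?exprn_gt0 ?mulr_gt0 ?Z_gt0.
have postE a x1 x2 : 0 < a ->
    post a x1 x2 b = c a * damped_weight A1 A2 Gamma G b a (x1, x2).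
  move=> a0; rewrite bayes// gaussian_pdf_scale ?spd_unitmx// -/kG.
  rewrite /c /damped_weight /flat_weight/=.
  by field; rewrite !gt_eqF ?Z_gt0.
have mdamped a : measurable_fun setT (damped_weight A1 A2 Gamma G b a).
  apply: measurable_funM; last exact: measurable_flat_weight.
  apply: (measurableT_comp (@measurable_expR R)); apply: measurable_funM => //.
  apply: measurable_funN; apply: measurable_funM => //.
  exact: (measurableT_comp (measurable_precision G)).
have damped_ge0 a x : 0 <= damped_weight A1 A2 Gamma G b a x.
  by rewrite mulr_ge0 ?expR_ge0 ?flat_weight_ge0.
have margE a x1 : 0 < a -> marginal1 (post a) x1 b =
    ((c a)%:E * \int[lebesgue_cV n2]_x2
       (damped_weight A1 A2 Gamma G b a (x1, x2))%:E)%E.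
  move=> a0; rewrite -ge0_integralZl_EFin//.
  - by apply: eq_integral => x2 _; rewrite postE.
  - by move=> x2 _; rewrite lee_fin.
  - apply/measurable_EFinP; apply: (measurableT_comp (mdamped a)).
    exact: measurable_fun_pair.
  - exact/ltW/c0.
(* the posterior density has mass 1, which determines the damped mass *)
have massE a : 0 < a -> (\int[lebesgue_cV n1 \x lebesgue_cV n2]_x
    (damped_weight A1 A2 Gamma G b a x)%:E = (c a)^-1%:E)%E.
  move=> a0; have [_ _ /(_ b) mass1 _] := condpost a a0.
  have : ((c a)%:E * \int[lebesgue_cV n1 \x lebesgue_cV n2]_x
      (damped_weight A1 A2 Gamma G b a x)%:E = 1)%E.
    rewrite -mass1 -ge0_integralZl_EFin//.
    - by apply: eq_integral => -[x1 x2] _; rewrite postE.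
    - by move=> x _; rewrite lee_fin.
    - by apply/measurable_EFinP; exact: mdamped.
    - exact/ltW/c0.
  move=> /(congr1 (fun z => (c a)^-1%:E * z)%E).
  by rewrite muleA -EFinM mulVf ?gt_eqF ?c0// mul1e mule1.
split.
- move=> x1; apply/cvge_at_rightP => u [u0 ucvg].
  under eq_fun do rewrite margE//.
  rewrite /projected_posterior -/(projected_weight _ _ _ _ _) -/F.
  (* V cancels in the quotient of the limits *)
  rewrite (_ : _ / F =
    (F * V)^-1 * (projected_weight A1 Gamma Pperp b x1 * V)); last first.
    by rewrite -/(projected_weight _ _ _ _ _); field; rewrite !gt_eqF.
  rewrite EFinM; apply: cvgeM => //.
    have : (\int[lebesgue_cV n1 \x lebesgue_cV n2]_x
        (damped_weight A1 A2 Gamma G b (u n) x)%:E)%E @[n --> \oo] --> (F * V)%:E.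
      exact: cvg_integral2_damped_weight.
    under eq_fun do rewrite massE//.
    move=> /fine_cvg cvgc; apply: cvg_EFin; first exact: nearW.
    have FV0 : F * V != 0 by rewrite gt_eqF// mulr_gt0.
    rewrite (_ : _ \o _ = (fun n => (c (u n))^-1^-1)); last first.
      by apply/funext => n /=; rewrite invrK.
    exact: (cvgV FV0 cvgc).
  exact: cvg_integral_damped_weight.
- exists (V / kG); first by rewrite divr_gt0.
  move=> x1; apply/cvge_at_rightP => u [u0 ucvg].
  under eq_fun => n.
    rewrite margE// muleA -EFinM (_ : _ * c (u n) = kG^-1); last first.
      by rewrite /c; field; rewrite !gt_eqF ?Z_gt0 ?exprn_gt0.
    over.
  rewrite (_ : V / kG * _ =
    kG^-1 * (projected_weight A1 Gamma Pperp b x1 * V)); last first.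
    by rewrite -/(projected_weight _ _ _ _ _); field; rewrite gt_eqF.
  rewrite EFinM; apply: cvgeMl => //.
  exact: cvg_integral_damped_weight.
Qed.
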